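(* For every $s\in\mathbb{N}$, whenever $n>(2s-1)^2$ (with $n\in\mathbb{N}$), $$\operatorname{rk}(q_n^s)<\frac{1}{n}\binom{2s+n-1}{2s}.$$ In particular, the rank of $q_n^s$ is subgeneric whenever $n>(2s-1)^2$.
   Context: Here $q_n=x_1^2+\cdots+x_n^2\in\mathbb{C}[x_1,\dots,x_n]$. For a homogeneous polynomial $f\in\mathbb{C}[x_1,\dots,x_n]$ of degree $d$, the (Waring) rank $\operatorname{rk} f$ is the smallest natural number $r$ such that $f=\sum_{j=1}^r l_j^d$ for some linear forms $l_1,\dots,l_r\in\mathbb{C}[x_1,\dots,x_n]$. The rank of a form of degree $d$ in $n$ variables is called subgeneric if it is strictly smaller than the generic rank, i.e. the rank of all forms in some non-empty Zariski open subset of the space of forms of degree $d$ in $n$ variables; by the Alexander–Hirschowitz theorem the generic rank equals $\bigl\lceil\frac{1}{n}\binom{d+n-1}{d}\bigr\rceil$, except for a few cases of degree $2$, $3$ and $4$.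
   Formalization: The claim is proved for s ≥ 2 only; it is false for s = 1 (every n > 1 has rk q_n = n > (n+1)/2, and n is the generic rank) and for s = 0 (rank 1 is not less than 1/n for n > 1). *)

(* Defs.v *)
(* The complex numbers are R[i] for a realType R. *)
From HB Require Import structures.
From mathcomp Require Import all_boot all_order all_algebra.
From mathcomp Require Import reals.
From mathcomp Require Import complex mpoly.

Set Implicit Arguments.
Unset Strict Implicit.
Unset Printing Implicit Defensive.

Import Order.TTheory GRing.Theory Num.Theory.
Local Open Scope ring_scope.

Definition qform (C : fieldType) (n : nat) : {mpoly C[n]} :=
  \sum_(i < n) 'X_i ^+ 2.

Definition sum_of_powers (C : fieldType) (n d : nat) (f : {mpoly C[n]})
    (r : nat) : Prop :=
  exists2 l : 'I_r -> {mpoly C[n]},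
    forall j, l j \is 1.-homog & f = \sum_(j < r) l j ^+ d.

(* The rank is a relation rather than a function, so that no default value is
   needed for forms that are not sums of d-th powers. *)
Definition is_rank (C : fieldType) (n d : nat) (f : {mpoly C[n]})
    (r : nat) : Prop :=
  sum_of_powers d f r /\ forall k, sum_of_powers d f k -> (r <= k)%N.

(* The monomials of degree d; 'X_{1..n < d.+1} is the finType of those of
   degree at most d. *)
Definition monomials (n d : nat) : {set 'X_{1..n < d.+1}} :=
  [set m : 'X_{1..n < d.+1} | mdeg m == d].

Definition coefs (C : fieldType) (n d : nat) (f : dhomog n C d)
    (i : 'I_#|monomials n d|) : C :=
  (mpoly_of_dhomog f)@_(enum_val i).

Definition zariski_closed (C : fieldType) (n d : nat)
    (Z : dhomog n C d -> Prop) : Prop :=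
  exists S : {mpoly C[#|monomials n d|]} -> Prop,
    forall f, Z f <-> forall p, S p -> p.@[coefs f] = 0.

Definition zariski_open (C : fieldType) (n d : nat)
    (U : dhomog n C d -> Prop) : Prop :=
  zariski_closed (fun f => ~ U f).

Definition is_generic_rank (C : fieldType) (n d g : nat) : Prop :=
  exists U : dhomog n C d -> Prop,
    [/\ zariski_open U, exists f, U f &
        forall f, U f -> is_rank d (mpoly_of_dhomog f) g].

Definition subgeneric_rank (C : fieldType) (n d : nat)
    (f : {mpoly C[n]}) : Prop :=
  exists r g, [/\ is_rank d f r, is_generic_rank C n d g & (r < g)%N].

(* Main.v *)
Require Import Defs.
From HB Require Import structures.
From mathcomp Require Import all_boot all_order all_algebra.
From mathcomp Require Import closed_field boolp reals.
From mathcomp Require Import complex ssrcomplements mpoly.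
From mathcomp Require Import zify ring.

(** Two independent facts give the theorem: an explicit short decomposition of
    q_n^s, and a dimension count that bounds the generic rank from below.

    Upper bound ([sum_of_powers_qform]).  Let z_0, ..., z_n be linear forms with
    sum 0 whose squares add up to q_n; they are the vertices of a regular simplex
    ([qform_simplex]).  In the algebra of formal power series,
      sum_i (exp z_i - 1) = (sum_i z_i) + (sum_i z_i^2) / 2 + ...
                          = q_n / 2 + (terms of degree at least 3),
    so the component of degree 2s of (sum_i (exp z_i - 1))^s is exactly
    (q_n / 2)^s.  Expanding the power gives a linear combination of exponentials
    of c.z = sum_i c_i z_i with c in N^{n+1} and |c| <= s, whose component of
    degree 2s is a combination of the powers (c.z)^{2s}.  The point c = 0
    contributes nothing, and a point with |c| = 1 is proportional to its double,
    which is also one of the points when s >= 2.  Hence the rank is at most the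
    number of points with 2 <= |c| <= s, namely C(n+1+s, s) - (n+2), and
    [qform_count_lt] compares this number with C(2s+n-1, 2s) / n.  For s = 2 the
    comparison says 12 < n + 3, which is where n > 9 comes from.  The argument is
    carried out without power series, by following the moments of the signed
    measure on N^{n+1} given by the coefficients of the expansion
    ([moment_laplacian]).

    Generic rank ([generic_rank_exists]).  The forms of degree d that are sums of
    k powers are the image of a polynomial map in k n variables.  By quantifier
    elimination such an image is constructible, so some non-empty principal open
    set either lies in it or misses it ([generic_image]).  The first case occurs
    for some k, because powers of linear forms span all forms, by polarization
    ([sum_of_powers_forms]).  The least such k is the generic rank g: on a
    non-empty open set, a form is a sum of g powers and not of g - 1.  If k n is
    smaller than the dimension of the space of forms then the coordinates of the
    map are algebraically dependent ([algebraic_dependence]), the image lies in a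
    hypersurface, and the first case is impossible.  Therefore g n is at least
    C(2s+n-1, 2s), which exceeds n times the rank of q_n^s. *)

Set Implicit Arguments.
Unset Strict Implicit.
Unset Printing Implicit Defensive.
Import Order.TTheory GRing.Theory Num.Theory.
Local Open Scope ring_scope.

(** * Moments of signed measures on a lattice *)

Section Moments.
Variables (F : fieldType) (A : comAlgType F) (N : nat) (z : 'I_N -> A).
Implicit Types (w : {mpoly F[N]}) (m : 'X_{1..N}) (j : nat).

Definition point m : A := \sum_i z i *+ m i.

(** A polynomial [w] stands for the finitely supported signed measure on N^N whose
    mass at [m] is the coefficient of ['X_[m]]; the product of polynomials is then
    the convolution of measures, and [moment j w] is the [j]-th moment of the
    image of [w] under [point].  It is [j]! times the component of degree [j] of
    [w] evaluated at the exponentials of the [z i]. *)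
Definition moment j w : A := \sum_(m <- msupp w) w@_m *: point m ^+ j.

Lemma momentwE k j w : (msize w <= k)%N ->
  moment j w = \sum_(m : 'X_{1..N < k}) w@_m *: point m ^+ j.
Proof.
move=> le_wk; rewrite /moment (big_mksub 'X_{1..N < k}) //=; first last.
- by move=> m /msize_mdeg_lt /leq_trans; apply.
- exact: msupp_uniq.
by rewrite big_rmcond //= => m /memN_msupp_eq0 ->; rewrite scale0r.
Qed.

Fact moment_is_linear j : linear (moment j).
Proof.
move=> c v w; pose k := maxn (msize v) (msize w).
have le_v : (msize v <= k)%N by rewrite leq_maxl.
have le_w : (msize w <= k)%N by rewrite leq_maxr.
have le_vw : (msize (c *: v + w) <= k)%N.
  rewrite (leq_trans (msizeD_le _ _)) // geq_max le_w andbT.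
  exact: leq_trans (mmeasureZ_le _ _ _) le_v.
rewrite !(@momentwE k) // scaler_sumr -big_split /=; apply: eq_bigr => m _.
by rewrite mcoeffD mcoeffZ scalerDl scalerA.
Qed.

HB.instance Definition _ j :=
  GRing.isLinear.Build F {mpoly F[N]} A _ (moment j) (moment_is_linear j).

Lemma momentX j m : moment j 'X_[m] = point m ^+ j.
Proof. by rewrite /moment msuppX big_seq1 mcoeffX eqxx scale1r. Qed.

Lemma pointD m1 m2 : point (m1 + m2)%MM = point m1 + point m2.
Proof.
by rewrite /point -big_split /=; apply: eq_bigr => i _; rewrite mnmDE mulrnDr.
Qed.

Lemma pointU i : point U_(i) = z i.
Proof.
rewrite /point (bigD1 i) //= mnm1E eqxx big1 ?addr0 // => k /negPf ne_ki.
by rewrite mnm1E eq_sym ne_ki.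
Qed.

Lemma moment0 j : moment j 1 = (j == 0%N)%:R.
Proof.
have -> : (1 : {mpoly F[N]}) = 'X_[0] by rewrite mpolyX0.
rewrite momentX /point big1 => [|i _]; last by rewrite mnm0E mulr0n.
by case: j => [|j]; rewrite ?expr0 // expr0n.
Qed.

(** Convolution with the difference of a unit mass at [U_(i)] and a unit mass at 0
    takes the difference of the [j]-th powers at [x + z i] and at [x]; the
    binomial formula expresses it by moments of order smaller than [j]. *)
Lemma moment_mulXB1 j w i :
  moment j (w * ('X_i - 1)) =
  \sum_(a < j) moment (j - a.+1) w * z i ^+ a.+1 *+ 'C(j, a.+1).
Proof.
elim/mpolyind: w => [|c m w _ _ IHw].
  by rewrite mul0r linear0 big1 // => a _; rewrite linear0 mul0r mul0rn.
rewrite mulrDl linearD /= IHw -scalerAl linearZ /= mulrBr mulr1.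
rewrite linearB /= -mpolyXD !momentX pointD pointU exprDn big_ord_recl /=.
rewrite subn0 expr0 mulr1 bin0 mulr1n addrAC subrr add0r scaler_sumr.
rewrite -big_split /=; apply: eq_bigr => a _.
by rewrite linearP /= momentX mulrDl mulrnDl -scalerAl scalerMnr.
Qed.

(** The polarization identity.  Each factor ['X_i - 1] acts as a finite difference
    and lowers degrees by at least one, so after [size r] of them only the leading
    term survives. *)
Lemma moment_polarization (r : seq 'I_N) (w := \prod_(i <- r) ('X_i - 1)) :
  (forall j, (j < size r)%N -> moment j w = 0) /\
  moment (size r) w = (\prod_(i <- r) z i) *+ (size r)`!.
Proof.
rewrite {}/w; elim: r => [|i r [IH0 IH]] /=.
  by rewrite !big_nil; split=> //; rewrite moment0.
rewrite !big_cons mulrC; split=> [j lt_jr|].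
  rewrite moment_mulXB1 big1 // => a _; rewrite IH0 ?mul0r ?mul0rn //.
  by have := ltn_ord a; lia.
rewrite moment_mulXB1 big_ord_recl /= subSS subn0 IH expr1 bin1.
rewrite [X in _ + X]big1 => [|a _]; last first.
  by rewrite IH0 ?mul0r ?mul0rn //= /bump; have := ltn_ord a; lia.
by rewrite addr0 mulrnAl -mulrnA mulnC -factS mulrC.
Qed.

(** When the [z i] have sum 0, the operator [\sum_i ('X_i - 1)] has no term of
    order one, so it lowers degrees by at least two; its leading term is half the
    sum of the squares of the [z i] times a second derivative. *)
Lemma moment_laplacian (k : nat) (w := \sum_i ('X_i - 1)) :
  \sum_i z i = 0 ->
  (forall j, (j < 2 * k)%N -> moment j (w ^+ k) = 0) /\
  moment (2 * k) (w ^+ k) *+ 2 ^ k = (\sum_i z i ^+ 2) ^+ k *+ (2 * k)`!.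
Proof.
move=> z0; have step j v : moment j (v * w) =
    \sum_(a < j) moment (j - a.+1) v * (\sum_i z i ^+ a.+1) *+ 'C(j, a.+1).
  rewrite mulr_sumr linear_sum /=; under eq_bigr do rewrite moment_mulXB1.
  rewrite exchange_big /=; apply: eq_bigr => a _.
  by rewrite mulr_sumr sumrMnl.
elim: k => [|k [IH0 IH]].
  by rewrite muln0 !expr0; split=> //; rewrite moment0.
rewrite exprSr; split=> [j lt_jk|].
  rewrite step big1 // => -[[|a] lt_aj] _ /=.
    by under eq_bigr do rewrite expr1; rewrite z0 mulr0 mul0rn.
  by rewrite IH0 ?mul0r ?mul0rn //; lia.
rewrite step mulnS add2n !big_ord_recl /= [X in _ *+ _ + (_ + X)]big1 => [|a _].
  under eq_bigr do rewrite expr1.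
  rewrite z0 mulr0 mul0rn add0r addr0 subSS subSS subn0 -mulrnA expnSr mulnA.
  have -> : ('C((2 * k).+2, 2) * 2 ^ k * 2 = 2 ^ k * ((2 * k).+2 * (2 * k).+1))%N.
    by rewrite mulnAC (bin_ffact _ 2) ffactnS ffactn1 mulnC.
  rewrite mulrnA -mulrnAl IH mulrnAl -mulrnA exprSr; congr (_ *+ _).
  by rewrite !factS mulnC mulnA.
by rewrite IH0 ?mul0r ?mul0rn //= /bump; have := ltn_ord a; lia.
Qed.

End Moments.

(** * Powers of linear forms *)

Section Degrees.
Variables (R : idomainType) (n : nat).
Implicit Types p q : {mpoly R[n]}.

Lemma msizeM_bound a b p q :
  (msize p <= a.+1)%N -> (msize q <= b.+1)%N -> (msize (p * q) <= (a + b).+1)%N.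
Proof.
have [->|p0] := eqVneq p 0; first by rewrite mul0r msize0.
have [->|q0] := eqVneq q 0; first by rewrite mulr0 msize0.
by rewrite msizeM //; lia.
Qed.

Lemma msizeXB1 i : (msize ('X_i - 1 : {mpoly R[n]}) <= 2)%N.
Proof.
rewrite (leq_trans (msizeD_le _ _)) // geq_max msizeX mdeg1 /=.
by rewrite mmeasureN msize1.
Qed.

End Degrees.

Section Powers.
Variables (C : numClosedFieldType) (n d : nat).
Hypothesis d_gt0 : (0 < d)%N.
Implicit Types f : {mpoly C[n]}.

(** Scalars are absorbed into the linear forms by extracting [d]-th roots. *)
Lemma sum_of_powers_span (I : finType) (P : {set I}) (a : I -> C)
    (l : I -> {mpoly C[n]}) :
  (forall i, l i \is 1.-homog) ->
  sum_of_powers d (\sum_(i in P) a i *: l i ^+ d) #|P|.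
Proof.
move=> l1; exists (fun j => d.-root (a (enum_val j)) *: l (enum_val j)).
  by move=> j; apply: dhomogZ.
by rewrite big_enum_val; apply: eq_bigr => j _; rewrite exprZn rootCK.
Qed.

Lemma sum_of_powers_leq f k k' :
  (k <= k')%N -> sum_of_powers d f k -> sum_of_powers d f k'.
Proof.
move=> le_kk' [l l1 ->].
rewrite -(subnKC le_kk').
exists (fun j => if split j is inl i then l i else 0) => [j|].
  by case: split => // _; apply: dhomog0.
rewrite big_split_ord /= [X in _ + X]big1 ?addr0 => [|j _].
  by apply: eq_bigr => j _; rewrite (unsplitK (inl j)).
by rewrite (unsplitK (inr j)) expr0n gtn_eqF.
Qed.

Lemma point_homog N (z : 'I_N -> {mpoly C[n]}) m :
  (forall i, z i \is 1.-homog) -> point z m \is 1.-homog.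
Proof. by move=> z1; apply: rpred_sum => i _; apply: rpredMn. Qed.

Lemma sum_of_powers_moment N (z : 'I_N -> {mpoly C[n]}) k w :
  (forall i, z i \is 1.-homog) -> (msize w <= k)%N ->
  sum_of_powers d (moment z d w) #|{: 'X_{1..N < k}}|.
Proof.
move=> z1 le_wk; rewrite (momentwE _ _ le_wk) -cardsT.
rewrite -(eq_bigl _ _ (fun m : 'X_{1..N < k} => in_setT m)).
by apply: sum_of_powers_span => m; apply: point_homog.
Qed.

(** Polarization with [z i = 'X_i] writes every monomial of degree [d], hence every
    form, as a combination of powers indexed by one common set of points. *)
Lemma sum_of_powers_forms f :
  f \is d.-homog -> sum_of_powers d f #|{: 'X_{1..n < d.+1}}|.
Proof.
move=> fd; have degf := dhomog_mf fd.
pose z i : {mpoly C[n]} := 'X_i.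
pose w m : {mpoly C[n]} := \prod_(i <- m2s m) ('X_i - 1).
have msz m : (msize (w m) <= (mdeg m).+1)%N.
  rewrite -size_m2s /w; elim: (m2s m) => [|i r IH].
    by rewrite big_nil msize1.
  by rewrite big_cons (msizeM_bound (msizeXB1 _ _) IH).
have mom m : mdeg m = d -> moment z d (w m) = (d`!)%:R *: 'X_[m].
  move=> <-; rewrite -size_m2s (moment_polarization z (m2s m)).2 scaler_nat.
  congr (_ *+ _); rewrite /m2s big_flatten big_map big_enum mpolyXE_id /=.
  by apply: eq_bigr => i _; rewrite big_nseq iter_mulr_1.
have -> : f = moment z d (\sum_(m <- msupp f) (f@_m / (d`!)%:R) *: w m).
  rewrite linear_sum /= [LHS]mpolyE !big_seq; apply: eq_bigr => m fm.
  rewrite linearZ /= mom ?scalerA ?divfK //; last exact: degf.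
  by rewrite pnatr_eq0 -lt0n fact_gt0.
apply: sum_of_powers_moment => [i|]; first by rewrite dhomogX /= mdeg1.
rewrite (leq_trans (msize_sum _ _ _)) // big_seq.
apply/bigmax_leqP_seq => m fm _.
rewrite (leq_trans (mmeasureZ_le _ _ _)) // (leq_trans (msz m)) //.
by rewrite degf.
Qed.

End Powers.

(** * The rank of a power of the quadratic form *)

(** With [e] the sum of the variables, take [z_0 = - t e] and [z_i = 'X_i + a e].
    The sum vanishes when [1 + n a = t], and the sum of squares is
    [q + (t^2 + 2 a + n a^2) e^2]; the last bracket vanishes for
    [t = 1 / sqrt (n + 1)]. *)
Lemma qform_simplex (C : numClosedFieldType) (n : nat) : (0 < n)%N ->
  exists z : 'I_n.+1 -> {mpoly C[n]},
    [/\ forall i, z i \is 1.-homog, \sum_i z i = 0 & \sum_i z i ^+ 2 = qform C n].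
Proof.
move=> n0; pose t : C := (sqrtC n.+1%:R)^-1; pose a := (t - 1) / n%:R.
pose e : {mpoly C[n]} := \sum_(i < n) 'X_i.
have Xh (i : 'I_n) : ('X_i : {mpoly C[n]}) \is 1.-homog.
  by rewrite dhomogX /= mdeg1.
have eh : e \is 1.-homog by apply: rpred_sum => i _.
have n0C : n%:R != 0 :> C by rewrite pnatr_eq0 -lt0n.
have aE : 1 + n%:R * a = t by rewrite mulrC divfK // addrC subrK.
have tE : t ^+ 2 * n.+1%:R = 1.
  by rewrite exprVn sqrtCK mulVf // pnatr_eq0.
exists (fun i => if unlift ord0 i is Some j then 'X_j + a *: e else - t *: e).
split=> [i||].
- by case: unlift => [j|]; rewrite ?dhomogZ // rpredD // dhomogZ.
- rewrite big_ord_recl unlift_none; under eq_bigr do rewrite liftK.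
  rewrite big_split /= sumr_const card_ord -/e -[X in _ + (X + _)]scale1r.
  by rewrite scalerMnl -!scalerDl -mulr_natl aE addNr scale0r.
rewrite big_ord_recl unlift_none; under eq_bigr do rewrite liftK sqrrD.
rewrite !big_split /= sumr_const card_ord -mulr_suml.
rewrite -/e -/(qform C n) !exprZn -scalerAr -expr2 sqrrN scalerMnl -scalerDl.
rewrite addrCA -addrA -[RHS]addr0; congr (_ + _); rewrite -!scalerDl.
suff -> : a + a + (t ^+ 2 + a ^+ 2 *+ n) = 0 by rewrite scale0r.
apply: (mulfI n0C); rewrite mulr0.
have -> : n%:R * (a + a + (t ^+ 2 + a ^+ 2 *+ n)) =
  t ^+ 2 * n.+1%:R - t ^+ 2 + (1 + n%:R * a) ^+ 2 - 1.
  by rewrite -mulr_natl -[n.+1%:R]natr1; ring.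
by rewrite aE tE; ring.
Qed.

(** The measure [(\sum_i ('X_i - 1)) ^+ s] is supported on the points of degree at
    most [s], and its moment of order [2 s] is proportional to [q^s].  The origin
    does not contribute, and each point of degree 1 is traded for its double. *)
Lemma sum_of_powers_qform (C : numClosedFieldType) (n s : nat) :
  (0 < n)%N -> (1 < s)%N ->
  sum_of_powers (2 * s) (qform C n ^+ s)
    #|[set m : 'X_{1..n.+1 < s.+1} | (1 < mdeg m)%N]|.
Proof.
move=> n0 s1; have [z [z1 sum_z sum_z2]] := qform_simplex C n0.
pose w : {mpoly C[n.+1]} := (\sum_i ('X_i - 1)) ^+ s.
have le_w : (msize w <= s.+1)%N.
  rewrite /w; elim: (s) => [|k IH]; first by rewrite expr0 msize1.
  rewrite exprS; apply: (msizeM_bound (a := 1) _ IH).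
  rewrite (leq_trans (msize_sum _ _ _)) //.
  by apply/bigmax_leqP => i _; apply: msizeXB1.
pose c : C := (2 ^ s)%:R / ((2 * s)`!)%:R.
have qE : qform C n ^+ s = c *: moment z (2 * s) w.
  apply: (@scalerI _ _ ((2 * s)`!)%:R); first by rewrite pnatr_eq0 -lt0n fact_gt0.
  rewrite scalerA mulrC divfK ?pnatr_eq0 -?lt0n ?fact_gt0 // !scaler_nat.
  by rewrite (moment_laplacian s sum_z).2 sum_z2.
pose h (m : 'X_{1..n.+1 < s.+1}) :=
  insubd m (if mdeg m == 1 then m *+ 2 else m)%MM.
have hE m : val (h m) = (if mdeg m == 1 then m *+ 2 else m)%MM.
  rewrite val_insubd; case: eqP => [m1|_]; last by rewrite bmdeg.
  by rewrite mdegMn m1 ltnS s1.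
pose k m := c * w@_m * (if mdeg m == 1 then (2 ^ (2 * s))%:R^-1 else 1).
have -> : qform C n ^+ s =
    \sum_(m : 'X_{1..n.+1 < s.+1} | (0 < mdeg m)%N)
      k m *: point z (h m) ^+ (2 * s).
  rewrite qE (momentwE _ _ le_w) scaler_sumr.
  rewrite (bigID (fun m : 'X_{1..n.+1 < s.+1} => (0 < mdeg m)%N)) /=.
  rewrite [X in _ + X]big1 ?addr0 => [|m].
    apply: eq_bigr => m _; rewrite hE /k.
    case: eqP => _; last by rewrite mulr1 scalerA.
    rewrite mulmS mulm1n pointD -mulr2n exprMn_n !scalerA.
    rewrite -scaler_nat scalerA; congr (_ *: _).
    by rewrite divfK // pnatr_eq0 -lt0n expn_gt0.
  rewrite -eqn0Ngt mdeg_eq0 => /eqP ->.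
  rewrite /point big1 => [|i _]; last by rewrite mnm0E.
  by rewrite expr0n muln_eq0 /= gtn_eqF ?(ltnW s1) // !scaler0.
rewrite (partition_big h (mem [set m : 'X_{1..n.+1 < s.+1} | (1 < mdeg m)%N])) /=.
  under eq_bigr => m _.
    under eq_bigr => m' /andP[_ /eqP ->] do over.
    rewrite -scaler_suml. over.
  apply: sum_of_powers_span => [|m]; [by lia | exact: point_homog].
by move=> m m0; rewrite inE hE; case: eqP => [m1|]; [rewrite mdegMn m1 | lia].
Qed.

Lemma card_mdeg_eq (n b k : nat) : (k < b)%N ->
  #|[set m : 'X_{1..n.+1 < b} | mdeg m == k]| = 'C(k + n, k).
Proof.
move=> lt_kb; rewrite -(size_basis n k) cardE -(size_map val).
apply/perm_size/uniq_perm; rewrite ?uniq_basis //.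
  by rewrite map_inj_uniq ?enum_uniq //; apply: val_inj.
move=> m; rewrite -basis_cover; apply/mapP/idP => [[m' +] ->|mk].
  by rewrite mem_enum inE.
have lt_mb : (mdeg m < b)%N by rewrite (eqP mk).
by exists (BMultinom lt_mb); rewrite // mem_enum inE.
Qed.

Lemma sum_bin_diag (n s : nat) :
  (\sum_(k < s.+1) 'C(k + n, k) = 'C(s + n.+1, s))%N.
Proof.
elim: s => [|s IH]; first by rewrite big_ord1 !bin0.
by rewrite big_ord_recr /= IH [in RHS]addSn binS addSnnS addnC.
Qed.

Lemma card_mdeg_gt1 (n s : nat) : (0 < s)%N ->
  (#|[set m : 'X_{1..n.+1 < s.+1} | (1 < mdeg m)%N]| + n.+2 = 'C(s + n.+1, s))%N.
Proof.
case: s => // s _; set b := s.+2; rewrite -sum_bin_diag.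
have card_deg (k : 'I_b) : 'C(k + n, k) =
    (\sum_(m : 'X_{1..n.+1 < b} | inord (mdeg m) == k) 1)%N.
  rewrite -(card_mdeg_eq n (ltn_ord k)) sum1dep_card; congr #|pred_of_set _|.
  apply/setP => m; rewrite !inE -val_eqE /= inordK //; exact: bmdeg.
pose deg (m : 'X_{1..n.+1 < b}) : 'I_b := inord (mdeg m).
rewrite -sum1dep_card (partition_big deg (fun k : 'I_b => (1 < k)%N)) /=; last first.
  by move=> m m1; rewrite /deg inordK //; apply: bmdeg.
rewrite [RHS](bigID (fun k : 'I_b => (1 < k)%N)) /=; congr (_ + _)%N.
  apply: eq_bigr => k k1; rewrite card_deg; apply: eq_bigl => m.
  apply/andb_idl => /eqP mk; move: k1; rewrite -mk /deg inordK //; exact: bmdeg.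
rewrite big_mkcond !big_ord_recl /= big1 ?addn0 => [|k _] /=; last by [].
by rewrite !bin0 add1n bin1.
Qed.

Lemma leq_ffact (a b k : nat) : (a <= b -> a ^_ k <= b ^_ k)%N.
Proof.
elim: k a b => // k IH a b le_ab; rewrite !ffactnS leq_mul // IH //.
by rewrite -!subn1 leq_sub2r.
Qed.

Lemma ffactnD (a j k : nat) : (a ^_ (j + k) = a ^_ j * (a - j) ^_ k)%N.
Proof.
elim: j a => [|j IH] a; first by rewrite subn0 ffactn0 mul1n.
by rewrite addSn !ffactnS IH mulnA -subn1 -subnDA add1n.
Qed.

(** For [s = 2] both sides are proportional to [(n+2)(n+1)n], and [12 < n + 3]
    remains.  For [s >= 3] the term [n.+2] can be dropped; after division by common
    factors the claim is [(2 s) ^_ s < n.+1 * (2 s + n - 1) ^_ (s - 2)].  Of the [s]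
    factors on the left, [2 s - 1] and [2 s - 2] are together compared with [n.+1],
    and each of the others with a factor that is larger than [n]. *)
Lemma qform_count_lt (n s : nat) : (1 < s)%N -> ((2 * s - 1) ^ 2 < n)%N ->
  (n * ('C(s + n.+1, s) - n.+2) < 'C(2 * s + n - 1, 2 * s))%N.
Proof.
case: s => [|[|[|k]]] // _ lt_sn.
  have e2 := bin_ffact (2 + n.+1) 2; have e4 := bin_ffact (2 * 2 + n - 1) 4.
  have E : (2 * 2 + n - 1 = n + 3)%N by lia.
  have E' : (2 + n.+1 = n + 3)%N by lia.
  move: e2 e4; rewrite {}E {}E' !ffactnS !ffactn0 !factS fact0 !addn3 /= !muln1.
  rewrite -[(2 * 2)%N]/4%N; move: ('C(_, 2)) ('C(_, 4)) => a b ea eb.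
  have n9 : (9 < n)%N by [].
  have e : ((a - n.+2) * 2 = n.+2 * n.+1)%N by rewrite mulnBl ea; nia.
  have e12 : (n * (a - n.+2) * 24 = n.+2 * (n.+1 * n) * 12)%N by nia.
  have : (n.+2 * (n.+1 * n) * 12 < n.+2 * (n.+1 * n) * n.+3)%N.
    by rewrite ltn_pmul2l // !muln_gt0 /=; lia.
  lia.
set s := k.+3 in lt_sn *.
have s_gt0 : (0 < (2 * s)`!)%N by rewrite fact_gt0.
apply: (@leq_ltn_trans (n * 'C(s + n.+1, s))).
  by rewrite leq_mul // leq_subr.
rewrite -(ltn_pmul2r s_gt0) bin_ffact -(@ffact_fact (2 * s) s); last by lia.
have -> : (2 * s - s = s)%N by lia.
have -> : (n * 'C(s + n.+1, s) * ((2 * s) ^_ s * s`!) =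
    (s + n.+1) ^_ s * n * (2 * s) ^_ s)%N.
  by rewrite -(bin_ffact (s + n.+1)); ring.
have -> : ((2 * s + n - 1) ^_ (2 * s) =
    (s + n.+1) ^_ s * n * (n.+1 * (2 * s + n - 1) ^_ k.+1))%N.
  have {2}-> : (2 * s = k.+1 + (s + 2))%N by lia.
  rewrite 2!ffactnD.
  have -> : (2 * s + n - 1 - k.+1 = s + n.+1)%N by lia.
  have ffact2 x : (x.+1 ^_ 2 = x.+1 * x)%N by rewrite ffactnS ffactn1.
  by rewrite addKn ffact2; ring.
rewrite ltn_pmul2l; last by rewrite muln_gt0 ffact_gt0; lia.
have -> : ((2 * s) ^_ s = 2 * s * (2 * s - 1) * (2 * s - 2) * (2 * s - 3) ^_ k)%N.
  rewrite /s !ffactnS -!subn1 -!subnDA !mulnA; congr (_ * _ * _ * _ ^_ _)%N; lia.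
rewrite ffactnS mulnA.
pose t := (2 * s + n - 1)%N.
apply: leq_ltn_trans (_ : 2 * s * (2 * s - 1) * (2 * s - 2) * t.-1 ^_ k < _)%N.
  by rewrite leq_mul // leq_ffact //; lia.
rewrite ltn_pmul2r; last by rewrite ffact_gt0; lia.
have lt_n : ((2 * s - 1) * (2 * s - 2) < n.+1)%N by nia.
rewrite -mulnA mulnC ltn_mul //; lia.
Qed.

(** * Zeros and algebraic dependence of polynomials *)

Lemma kronecker_inj (B n : nat) (a b : 'I_n -> nat) :
  (forall i, a i < B)%N -> (forall i, b i < B)%N ->
  (\sum_i a i * B ^ i = \sum_i b i * B ^ i)%N -> a =1 b.
Proof.
elim: n a b => [|n IH] a b lt_a lt_b eq_ab i; first by case: i.
have B0 : (0 < B)%N by rewrite (leq_ltn_trans _ (lt_a i)).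
have digits (c : 'I_n.+1 -> nat) :
    (\sum_i c i * B ^ i = (\sum_i c (lift ord0 i) * B ^ i) * B + c ord0)%N.
  rewrite big_ord_recl expn0 muln1 addnC big_distrl /=; congr (_ + _)%N.
  by apply: eq_bigr => j _; rewrite -mulnA -expnSr.
rewrite !digits in eq_ab.
have eq0 : a ord0 = b ord0.
  by have := congr1 (modn^~ B) eq_ab; rewrite !modnMDl !modn_small.
move: eq_ab; rewrite eq0 => /addIn /eqP; rewrite eqn_pmul2r //.
move=> /eqP /IH eq_lift.
by case: (unliftP ord0 i) => [j|] -> //; apply: eq_lift.
Qed.

Lemma poly_nonroot (F : numDomainType) (p : {poly F}) :
  p != 0 -> exists x, p.[x] != 0.
Proof.
move=> p0; pose rs := [seq i%:R : F | i <- iota 0 (size p)].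
have : ~~ all (root p) rs.
  apply/negP => all_rs; have /(max_poly_roots p0 all_rs) : uniq rs.
    by rewrite map_inj_uniq ?iota_uniq //; apply: (mulrIn (oner_neq0 F)).
  by rewrite size_map size_iota ltnn.
by case/allPn => x _ px; exists x.
Qed.

(** Kronecker's substitution: replacing the [i]-th variable by [x ^+ (B ^ i)], with
    [B] larger than all exponents, sends distinct monomials of [p] to distinct
    powers of [x]. *)
Lemma mpoly_nonvanishing (F : numDomainType) (n : nat) (p : {mpoly F[n]}) :
  p != 0 -> exists v, p.@[v] != 0.
Proof.
move=> p0; pose B := msize p; pose k (m : 'X_{1..n}) := (\sum_i m i * B ^ i)%N.
have ltB (m : 'X_{1..n}) i : m \in msupp p -> (m i < B)%N.
  move/msize_mdeg_lt; apply: leq_ltn_trans.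
  by rewrite mdegE (bigD1 i) //= leq_addr.
pose P : {poly F} := \sum_(m <- msupp p) p@_m *: 'X^(k m).
have coefP m : m \in msupp p -> P`_(k m) = p@_m.
  move=> pm; rewrite coef_sum (bigD1_seq m) ?msupp_uniq //=.
  rewrite coefZ coefXn eqxx mulr1.
  rewrite big_seq_cond big1 ?addr0 // => m' /andP[pm' ne_m'].
  rewrite coefZ coefXn.
  case: eqP => [/kronecker_inj eq_m|]; last by rewrite mulr0.
  case/eqP: ne_m'; apply/mnmP => i; apply/esym/eq_m => j; exact: ltB.
have P0 : P != 0.
  have pm := mlead_supp p0; apply: contraTneq pm => P0.
  by rewrite mcoeff_msupp negbK -coefP ?P0 ?coef0 // mlead_supp.
have [x Px] := poly_nonroot P0; exists (fun i => x ^+ (B ^ i)).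
congr (_ != 0): Px; rewrite mevalE /P horner_sum; apply: eq_bigr => m _.
rewrite hornerZ hornerXn /k expr_sum; congr (_ * _).
by apply: eq_bigr => i _; rewrite -exprM mulnC.
Qed.

(** More polynomials than variables are algebraically dependent.  The [M ^ D]
    monomials in the [f i] with exponents below [M] lie in the span of the [E ^ N]
    monomials with exponents below [E], where [E] is linear in [M]; for large [M]
    there are more of the former than of the latter. *)
Lemma algebraic_dependence (F : fieldType) (N D : nat) 
    (f : 'I_D -> {mpoly F[N]}) : (N < D)%N ->
  exists2 P : {mpoly F[D]}, P != 0 & forall v, P.@[fun i => (f i).@[v]] = 0.
Proof.
move=> lt_ND; pose K := (\max_i msize (f i))%N; pose b := (D * K).+1.
(* E = b M, and M > b ^ N gives E ^ N = b ^ N * M ^ N < M ^ N.+1 <= M ^ D *)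
pose M := (b ^ N).+1; pose E := (b * M)%N.
pose prodf (s : {ffun 'I_D -> 'I_M}) := \prod_i f i ^+ s i.
pose mon (t : {ffun 'I_N -> 'I_E}) := [multinom (t i : nat) | i < N].
have lt_card : (#|{ffun 'I_N -> 'I_E}| < #|{ffun 'I_D -> 'I_M}|)%N.
  rewrite !card_ffun !card_ord (@leq_trans (M ^ N.+1)) ?leq_pexp2l //.
  by rewrite expnMn expnS ltn_pmul2r ?expn_gt0.
have size_exp (g : {mpoly F[N]}) a k :
    (msize g <= a.+1)%N -> (msize (g ^+ k) <= (k * a).+1)%N.
  move=> le_ga; elim: k => [|k IH]; first by rewrite expr0 msize1.
  by rewrite exprS mulSn; apply: msizeM_bound.
have size_prodf s : (msize (prodf s) <= E)%N.
  have : (msize (prodf s) <= (\sum_(i < D) s i * K).+1)%N.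
    rewrite /prodf; elim/big_rec2: _ => [|i a p _ IH]; first by rewrite msize1.
    apply: msizeM_bound IH; apply: size_exp.
    exact: leq_trans (leq_bigmax i) (leqnSn K).
  move=> le_s; apply: (leq_trans le_s).
  apply: (@leq_trans (\sum_(i < D) b ^ N * K).+1).
    by rewrite ltnS; apply: leq_sum => i _; rewrite leq_mul // -ltnS ltn_ord.
  by rewrite sum_nat_const card_ord /E /M /b mulnCA mulnA; nia.
(* a linear relation u between the rows yields the algebraic relation P *)
pose A := \matrix_(s < #|{ffun 'I_D -> 'I_M}|, t < #|{ffun 'I_N -> 'I_E}|)
  (prodf (enum_val s))@_(mon (enum_val t)).
have /rowV0Pn[u /sub_kermxP uA u0] : kermx A != 0.
  rewrite kermx_eq0 /row_free; apply: contraTneq lt_card => <-.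
  by rewrite -leqNgt rank_leq_col.
pose e (s : {ffun 'I_D -> 'I_M}) := [multinom (s i : nat) | i < D].
have e_inj : injective e.
  move=> s s' /mnmP eq_ss'; apply/ffunP => i; apply: val_inj.
  by have := eq_ss' i; rewrite !mnmE.
pose P : {mpoly F[D]} := \sum_s u 0 s *: 'X_[e (enum_val s)].
exists P => [|v].
  have [s us] : exists s, u 0 s != 0.
    apply/existsP; apply: contraNT u0; rewrite negb_exists => /forallP us.
    by apply/eqP/rowP => s; rewrite mxE; apply/eqP; have := us s; rewrite negbK.
  apply: contraNneq us => /(congr1 (mcoeff (e (enum_val s)))).
  rewrite mcoeff0 linear_sum (bigD1 s) //= mcoeffZ mcoeffX eqxx mulr1 big1 ?addr0.
    by move=> ->.
  move=> s' ne_s'; rewrite mcoeffZ mcoeffX (inj_eq e_inj) (inj_eq enum_val_inj).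
  by rewrite (negPf ne_s') mulr0.
have PfE : P.@[fun i => (f i).@[v]] = (\sum_s u 0 s *: prodf (enum_val s)).@[v].
  rewrite !linear_sum; apply: eq_bigr => s _.
  rewrite /= !mevalZ mevalX rmorph_prod.
  by congr (_ * _); apply: eq_bigr => i _; rewrite rmorphXn mnmE.
rewrite {}PfE [X in X.@[v]](_ : _ = 0) ?meval0 //; apply/mpolyP => m.
rewrite mcoeff0 linear_sum /=; under eq_bigr do rewrite mcoeffZ.
have [lt_mE|] := boolP [forall i : 'I_N, (m i < E)%N]; last first.
  move=> /forallPn[i0]; rewrite -leqNgt => le_Em.
  rewrite big1 // => s _.
  rewrite memN_msupp_eq0 ?mulr0 // msize_mdeg_ge // (leq_trans (size_prodf _)) //.
  by rewrite (leq_trans le_Em) // mdegE (bigD1 i0) //= leq_addr.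
pose t := [ffun i => Ordinal (forallP lt_mE i)].
have mE : mon t = m by apply/mnmP => i; rewrite mnmE ffunE.
have /matrixP/(_ 0 (enum_rank t)) := uA; rewrite mxE [RHS]mxE => uAt.
by rewrite -[RHS]uAt; apply: eq_bigr => s _; rewrite mxE enum_rankK mE.
Qed.

(** * Properties that hold generically *)

(** Over an infinite field, [h != 0] says that the principal open set where [h] does
    not vanish is non-empty. *)
Definition generic (F : fieldType) (D : nat) (Q : ('I_D -> F) -> Prop) :=
  exists2 h : {mpoly F[D]}, h != 0 & forall y, h.@[y] != 0 -> Q y.

Section Generic.
Variables (F : fieldType) (D : nat).
Implicit Types (Q : ('I_D -> F) -> Prop).

Lemma generic_all Q : (forall y, Q y) -> generic Q.
Proof. by move=> Qy; exists 1; first exact: oner_neq0. Qed.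

Lemma generic_sub Q1 Q : (forall y, Q1 y -> Q y) -> generic Q1 -> generic Q.
Proof. by move=> Q1Q [h h0 hQ1]; exists h => // y /hQ1/Q1Q. Qed.

Lemma generic_sub2 Q1 Q2 Q : (forall y, Q1 y -> Q2 y -> Q y) ->
  generic Q1 -> generic Q2 -> generic Q.
Proof.
move=> Q12 [h1 h1_0 hQ1] [h2 h2_0 hQ2].
exists (h1 * h2); first exact: mulf_neq0.
move=> y; rewrite mevalM mulf_eq0 negb_or => /andP[y1 y2].
by apply: Q12; [apply: hQ1 | apply: hQ2].
Qed.

End Generic.

Lemma generic_ex (F : numFieldType) (D : nat) (Q : ('I_D -> F) -> Prop) :
  generic Q -> exists y, Q y.
Proof. by case=> h /mpoly_nonvanishing[y hy] hQ; exists y; apply: hQ. Qed.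

Section Environments.
Variables (F : fieldType) (N : nat).
Implicit Types y : 'I_N -> F.

Definition env y : seq F := [tuple y k | k < N].

Lemma size_env y : size (env y) = N.
Proof. exact: size_tuple. Qed.

Lemma nth_env y (k : 'I_N) : (env y)`_k = y k.
Proof. by rewrite -tnth_nth tnth_mktuple. Qed.

End Environments.

Section GenericDecision.
Variables (F : closedFieldType) (D : nat).
Implicit Types (y : 'I_D -> F) (phi : GRing.formula F).

(** Variables beyond the first [D] are sent to 0, which is the default value of
    environments; inverses do not occur in the terms considered below. *)
Fixpoint mpoly_of_term (t : GRing.term F) : {mpoly F[D]} :=
  match t with
  | GRing.Var k => if insub k is Some j then 'X_j else 0
  | GRing.Const c => c%:MP
  | GRing.NatConst k => k%:R
  | GRing.Add t1 t2 => mpoly_of_term t1 + mpoly_of_term t2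
  | GRing.Opp t1 => - mpoly_of_term t1
  | GRing.NatMul t1 k => mpoly_of_term t1 *+ k
  | GRing.Mul t1 t2 => mpoly_of_term t1 * mpoly_of_term t2
  | GRing.Inv _ => 0
  | GRing.Exp t1 k => mpoly_of_term t1 ^+ k
  end.

Lemma eval_env y t :
  GRing.rterm t -> GRing.eval (env y) t = (mpoly_of_term t).@[y].
Proof.
elim: t => //=.
- move=> k _; case: insubP => [j _ <-|]; first by rewrite mevalXU nth_env.
  by rewrite -leqNgt => le_Dk; rewrite meval0 nth_default // size_env.
- by move=> c _; rewrite mevalC.
- by move=> k _; rewrite rmorph_nat.
- by move=> t1 IH1 t2 IH2 /andP[/IH1 -> /IH2 ->]; rewrite mevalD.
- by move=> t1 IH1 /IH1 ->; rewrite mevalN.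
- by move=> t1 IH1 k /IH1 ->; rewrite mevalMn.
- by move=> t1 IH1 t2 IH2 /andP[/IH1 -> /IH2 ->]; rewrite mevalM.
- by move=> t1 IH1 k /IH1 ->; rewrite rmorphXn.
Qed.

(** An equation is either an identity or fails outside a hypersurface, and
    connectives preserve being generically constant. *)
Lemma generic_qf_eval phi : GRing.qf_form phi -> GRing.rformula phi ->
  exists b, generic (fun y => GRing.qf_eval (env y) phi = b).
Proof.
pose constant p := exists b, generic (fun y => GRing.qf_eval (env y) p = b).
have connective p1 p2 p (op : bool -> bool -> bool) :
    (forall e, GRing.qf_eval e p =
       op (GRing.qf_eval e p1) (GRing.qf_eval e p2)) ->
    constant p1 -> constant p2 -> constant p.
  move=> opE [b1 gen1] [b2 gen2]; exists (op b1 b2).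
  by apply: generic_sub2 gen1 gen2 => y; rewrite opE => -> ->.
elim: phi => //=.
- by move=> b _ _; exists b; apply: generic_all.
- move=> t1 t2 _ /andP[r1 r2]; pose p := mpoly_of_term t1 - mpoly_of_term t2.
  have pE y : (GRing.eval (env y) t1 == GRing.eval (env y) t2) = (p.@[y] == 0).
    by rewrite !eval_env // -subr_eq0 -mevalB.
  have [p0|p_neq0] := eqVneq p 0.
    by exists true; apply: generic_all => y; rewrite pE p0 meval0 eqxx.
  by exists false, p => // y /negPf <-; rewrite pE.
- move=> p1 IH1 p2 IH2 /andP[/IH1 {}IH1 /IH2 {}IH2] /andP[/IH1 {}IH1 /IH2 {}IH2].
  exact: (connective p1 p2 (GRing.And p1 p2) andb (fun=> erefl)).
- move=> p1 IH1 p2 IH2 /andP[/IH1 {}IH1 /IH2 {}IH2] /andP[/IH1 {}IH1 /IH2 {}IH2].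
  exact: (connective p1 p2 (GRing.Or p1 p2) orb (fun=> erefl)).
- move=> p1 IH1 p2 IH2 /andP[/IH1 {}IH1 /IH2 {}IH2] /andP[/IH1 {}IH1 /IH2 {}IH2].
  exact: (connective p1 p2 (GRing.Implies p1 p2) implb (fun=> erefl)).
- move=> p IH /IH {}IH /IH [b gen_p].
  by exists (~~ b); apply: generic_sub gen_p => y ->.
Qed.

Lemma generic_holds phi : GRing.rformula phi ->
  generic (fun y => GRing.holds (env y) phi) \/
  generic (fun y => ~ GRing.holds (env y) phi).
Proof.
move=> rphi.
have wf := @ClosedFieldQE.wf_ex_elim F.
have ok := ClosedFieldQE.holds_ex_elim (@solve_monicpoly F).
have /andP[qf rqf] := GRing.quantifier_elim_wf wf rphi.
have phiP e := GRing.quantifier_elim_rformP wf ok e rphi.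
have [[] gen_b] := generic_qf_eval qf rqf; [left | right].
  by apply: generic_sub gen_b => y yb; apply/phiP.
by apply: generic_sub gen_b => y yb /phiP; rewrite yb.
Qed.

(** The variables of [p] are named [D], ..., [D + N - 1], so that the first [D]
    names remain free for the coordinates of a point of the target. *)
Lemma term_of_mpoly N (p : {mpoly F[N]}) :
  exists t : GRing.term F, GRing.rterm t /\
    forall e, GRing.eval e t = p.@[fun k => e`_(D + k)].
Proof.
have monom (m : 'X_{1..N}) : exists t : GRing.term F, GRing.rterm t /\
    forall e, GRing.eval e t = \prod_(k < N) e`_(D + k) ^+ m k.
  elim: (index_enum 'I_N) => [|k r [t [rt tE]]].
    by exists (GRing.NatConst F 1); split=> // e; rewrite big_nil.
  exists (GRing.Mul (GRing.Exp (GRing.Var F (D + k)) (m k)) t).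
  by split=> // e; rewrite big_cons /= tE.
elim/mpolyind: p => [|c m p _ _ [t [rt tE]]].
  by exists (GRing.NatConst F 0); split=> // e; rewrite meval0.
have [u [ru uE]] := monom m.
exists (GRing.Add (GRing.Mul (GRing.Const c) u) t); split=> [|e] /=.
  by rewrite ru.
by rewrite mevalD mevalZ mevalX uE tE.
Qed.

(** A form of Chevalley's theorem: the image is defined by an existential formula,
    and quantifier elimination makes its truth value generically constant. *)
Lemma generic_image N (f : 'I_D -> {mpoly F[N]})
    (image := fun y => exists v, forall k, (f k).@[v] = y k) :
  generic image \/ generic (fun y => ~ image y).
Proof.
have [t /all_and2[rt tE]] := fin_all_exists (fun k => term_of_mpoly (f k)).
pose body := foldr (@GRing.And F) (GRing.Bool true)
  [seq GRing.Equal (GRing.Var F k) (t k) | k : 'I_D <- enum 'I_D].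
pose phi := foldr (@GRing.Exists F) body (iota D N).
have bodyP e : GRing.holds e body <-> forall k : 'I_D, e`_k = GRing.eval e (t k).
  have -> : GRing.holds e body <->
      forall k, k \in enum 'I_D -> e`_k = GRing.eval e (t k).
    rewrite /body; elim: (enum 'I_D) => [|k r IH] /=; first by split.
    rewrite IH; split=> [[ek er] j|er].
      by rewrite inE => /predU1P[->|/er].
    by split=> [|j rj]; apply: er; rewrite inE ?eqxx ?rj ?orbT.
  by split=> eE k => [|_]; apply: eE; rewrite mem_enum.
have rphi : GRing.rformula phi.
  rewrite /phi; elim: (iota D N) => //=; rewrite /body.
  by elim: (enum 'I_D) => //= k r ->; rewrite rt.
have phiP y : GRing.holds (env y) phi <-> image y.
  rewrite -GRing.foldExistsP; split=> [[e ye /bodyP eE]|[v yE]].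
    exists (fun k => e`_(D + k)) => k; rewrite -tE -eE -ye ?nth_env //.
    by rewrite !inE mem_iota leqNgt ltn_ord.
  exists (env y ++ env v) => [k|].
    rewrite !inE mem_iota nth_cat size_env negb_and -ltnNge -leqNgt.
    move=> /orP[-> //|le_k]; rewrite ltnNge (leq_trans (leq_addr _ _) le_k) /=.
    by rewrite !nth_default ?size_env //; lia.
  apply/bodyP => k; rewrite tE nth_cat size_env ltn_ord nth_env -yE.
  apply: meval_eq => j; rewrite nth_cat size_env ltnNge leq_addr /= addKn.
  by rewrite nth_env.
by case: (generic_holds rphi) => gen_phi; [left | right];
  apply: generic_sub gen_phi => y; rewrite phiP.
Qed.

End GenericDecision.

(** * The generic rank *)

Section GenericRank.
Variables (C : numClosedFieldType) (n d : nat).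
Local Notation D := #|monomials n d|.
Implicit Types (f : dhomog n C d) (y : 'I_D -> C) (k : nat).

Lemma mdeg_monomials (i : 'I_D) : mdeg (enum_val i : 'X_{1..n < d.+1}) = d.
Proof. by have := enum_valP i; rewrite inE => /eqP. Qed.

Lemma coefs_surj y : exists f, coefs f =1 y.
Proof.
pose p : {mpoly C[n]} := \sum_(i < D) y i *: 'X_[enum_val i].
have pd : p \is d.-homog.
  by apply: rpred_sum => i _; apply: dhomogZ; rewrite dhomogX /= mdeg_monomials.
exists (DHomog pd) => i; rewrite /coefs /= linear_sum (bigD1 i) //=.
rewrite mcoeffZ mcoeffX eqxx mulr1 big1 ?addr0 // => j /negPf ne_ji.
by rewrite mcoeffZ mcoeffX (inj_eq val_inj) (inj_eq enum_val_inj) ne_ji mulr0.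
Qed.

Lemma coefs_inj f (p : {mpoly C[n]}) : p \is d.-homog ->
  (forall i : 'I_D, coefs f i = p@_(enum_val i)) -> mpoly_of_dhomog f = p.
Proof.
move=> pd fp; apply/mpolyP => m.
have [md|ne_md] := eqVneq (mdeg m) d; last first.
  by rewrite !(dhomog_nemf_coeff _ ne_md) //; apply: dhomog_is_dhomog.
have lt_md : (mdeg m < d.+1)%N by rewrite md.
pose b := BMultinom lt_md; have bM : b \in monomials n d by rewrite inE /= md.
by have := fp (enum_rank_in bM b); rewrite /coefs enum_rankK_in.
Qed.

Definition vars k := #|{: 'I_k * 'I_n}|.

Definition linear_form k (v : 'I_(vars k) -> C) (j : 'I_k) : {mpoly C[n]} :=
  \sum_t v (enum_rank (j, t)) *: 'X_t.

(** A coefficient of a sum of [k] powers of linear forms, as a polynomial in the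
    coefficients of the linear forms. *)
Definition power_sum_coef k (m : 'X_{1..n}) : {mpoly C[vars k]} :=
  (\sum_(j < k) (\sum_t 'X_(enum_rank (j, t)) *: 'X_t :
     {mpoly {mpoly C[vars k]}[n]}) ^+ d)@_m.

Lemma power_sum_coefE k m (v : 'I_(vars k) -> C) :
  (power_sum_coef k m).@[v] = (\sum_(j < k) linear_form v j ^+ d)@_m.
Proof.
rewrite /power_sum_coef -(mcoeff_map_mpoly (meval v)) rmorph_sum /=.
congr (_@__); apply: eq_bigr => j _; rewrite rmorphXn rmorph_sum /=.
congr (_ ^+ d); apply: eq_bigr => t _.
by rewrite map_mpolyZ map_mpolyX /= mevalXU.
Qed.

Lemma linear_form_homog k (v : 'I_(vars k) -> C) j :
  linear_form v j \is 1.-homog.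
Proof. by apply: rpred_sum => t _; apply: dhomogZ; rewrite dhomogX /= mdeg1. Qed.

Lemma homog1E (l : {mpoly C[n]}) :
  l \is 1.-homog -> l = \sum_t l@_U_(t) *: 'X_t.
Proof.
move=> l1; apply/mpolyP => m; rewrite linear_sum /=.
under eq_bigr do rewrite mcoeffZ mcoeffX.
have [m1|ne_m1] := eqVneq (mdeg m) 1%N; last first.
  rewrite (dhomog_nemf_coeff l1 ne_m1) big1 // => t _.
  by case: eqP => [m_t|_]; [rewrite -m_t mdeg1 eqxx in ne_m1 | rewrite mulr0].
have /mdeg1P[t /eqP ->] : mdeg m == 1%N by apply/eqP.
rewrite (bigD1 t) //= eqxx mulr1 big1 ?addr0 // => u ne_ut.
by rewrite eq_mnm1 (negPf ne_ut) mulr0.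
Qed.

Definition power_sum k y :=
  exists v, forall i : 'I_D, (power_sum_coef k (enum_val i)).@[v] = y i.

Lemma power_sumP k f :
  sum_of_powers d (mpoly_of_dhomog f) k <-> power_sum k (coefs f).
Proof.
split=> [[l l1 fE]|[v vE]].
  exists (fun r => (l (enum_val r).1)@_U_((enum_val r).2)) => i.
  rewrite power_sum_coefE /coefs fE; congr (_@__); apply: eq_bigr => j _.
  congr (_ ^+ d); rewrite [RHS]homog1E //.
  by apply: eq_bigr => t _; rewrite enum_rankK.
exists (linear_form v) => [j|]; first exact: linear_form_homog.
apply: coefs_inj => [|i]; last by rewrite -vE power_sum_coefE.
apply: rpred_sum => j _.
by have := dhomogMn d (linear_form_homog v j); rewrite mul1n.
Qed.

Lemma eq_power_sum k y1 y2 : y1 =1 y2 -> power_sum k y1 -> power_sum k y2.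
Proof. by move=> eq_y [v vE]; exists v => i; rewrite vE. Qed.

(** Sums of too few powers satisfy a polynomial equation, because there are fewer
    parameters than coordinates. *)
Lemma generic_power_sum_bound k : generic (power_sum k) -> (D <= k * n)%N.
Proof.
move=> gen_k; rewrite leqNgt; apply/negP => lt_knD.
have lt_vars : (vars k < D)%N by rewrite /vars card_prod !card_ord.
have [P P0 Pf] :=
  algebraic_dependence (fun i : 'I_D => power_sum_coef k (enum_val i)) lt_vars.
have gen_P : generic (fun y : 'I_D -> C => P.@[y] != 0) by exists P.
have [y [[v vE] /eqP[]]] : exists y, power_sum k y /\ P.@[y] != 0.
  by apply: generic_ex; apply: generic_sub2 gen_k gen_P.
by rewrite -(Pf v); apply: meval_eq => i; rewrite vE.
Qed.

Lemma generic_rank_exists : (0 < d)%N -> (0 < D)%N ->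
  exists2 g, is_generic_rank C n d g & (D <= g * n)%N.
Proof.
move=> d_gt0 D_gt0.
have ex_g : exists k, `[< generic (power_sum k) >].
  exists #|{: 'X_{1..n < d.+1}}|; apply/asboolP/generic_all => y.
  have [f fy] := coefs_surj y; apply: (eq_power_sum fy); apply/power_sumP.
  by apply: sum_of_powers_forms => //; apply: dhomog_is_dhomog.
case: (ex_minnP ex_g) => g /asboolP gen_g min_g.
have le_Dg := generic_power_sum_bound gen_g.
exists g => //; case: g le_Dg gen_g min_g => [|g] le_Dg gen_g min_g.
  by rewrite mul0n leqNgt D_gt0 in le_Dg.
have gen_not_g : generic (fun y => ~ power_sum g y).
  have [|//] := generic_image (fun i : 'I_D => power_sum_coef g (enum_val i)).
  by move=> /asboolP /min_g; rewrite ltnn.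
have [h h0 hP] : generic (fun y => power_sum g.+1 y /\ ~ power_sum g y).
  exact: generic_sub2 gen_g gen_not_g.
exists (fun f => h.@[coefs f] != 0); split.
- exists (fun p => p = h) => f; split=> [/negP/negPn/eqP hf p -> //|hf].
  by rewrite hf ?eqxx.
- have [y hy] := mpoly_nonvanishing h0.
  by have [f fy] := coefs_surj y; exists f; rewrite (meval_eq _ fy).
move=> f /hP[fg not_fg]; split=> [|k fk]; first exact/power_sumP.
rewrite ltnNge; apply/negP => le_kg; apply/not_fg/power_sumP.
exact: (sum_of_powers_leq d_gt0 le_kg).
Qed.

End GenericRank.

Lemma is_rank_exists (C : fieldType) n d (f : {mpoly C[n]}) b :
  sum_of_powers d f b -> exists2 r, is_rank d f r & (r <= b)%N.
Proof.
move=> fb; have ex_r : exists k, `[< sum_of_powers d f k >].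
  by exists b; apply/asboolP.
case: (ex_minnP ex_r) => r /asboolP fr min_r.
by exists r; [split=> // k fk | ]; apply: min_r; apply/asboolP.
Qed.

(** * The rank of a power of the quadratic form is subgeneric *)

Unset Implicit Arguments.

Theorem theorem1p7 (R : realType) (s n : nat)
    (hs : (2 <= s)%N) (hn : ((2 * s - 1) ^ 2 < n)%N) :
  (exists2 r : nat, is_rank (2 * s) (qform R[i] n ^+ s) r
     & r%:R < n%:R^-1 * ('C(2 * s + n - 1, 2 * s))%:R :> rat)
  /\ subgeneric_rank (2 * s) (qform R[i] n ^+ s).
Proof.
have n_gt0 : (0 < n)%N by apply: leq_ltn_trans hn.
have d_gt0 : (0 < 2 * s)%N by lia.
have [r rk_r le_r] := is_rank_exists (sum_of_powers_qform R[i] n_gt0 hs).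
have lt_r : (n * r < 'C(2 * s + n - 1, 2 * s))%N.
  apply: leq_ltn_trans (qform_count_lt hs hn); rewrite leq_mul2l.
  by rewrite -(card_mdeg_gt1 n (ltnW hs)) addnK le_r orbT.
split.
  by exists r => //; rewrite mulrC ltr_pdivlMr ?ltr0n // -natrM ltr_nat mulnC.
have cardD : #|monomials n (2 * s)| = 'C(2 * s + n - 1, 2 * s).
  rewrite /monomials; case: (n) n_gt0 => // n' _.
  by rewrite card_mdeg_eq // addnS subn1.
have D_gt0 : (0 < #|monomials n (2 * s)|)%N by rewrite cardD bin_gt0; lia.
have [g gen_g le_g] := generic_rank_exists R[i] d_gt0 D_gt0.
exists r, g; split=> //.
by rewrite -(ltn_pmul2l n_gt0) (leq_trans lt_r) // -cardD [(n * g)%N]mulnC.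
Qed.
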